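(* Let $n\ge 1$, $\alpha\in(0,1)$, let $\mathbf v\in\mathbb R^n$ with $\mathbf v\ge 0$ and $\mathbf 1_n^\top \mathbf v=1$, and let $R\in\mathbb R^{n\times n^2}$ with $R\ge 0$ and $\mathbf 1_n^\top R=\mathbf 1_{n^2}^\top$. Then the equation $\mathbf x=\alpha R(\mathbf x\otimes\mathbf x)+(1-\alpha)\mathbf v$ has a minimal nonnegative solution $\mathbf m$, and: (1) (subcritical case) if $\alpha\le\frac12$, then $\mathbf m$ is stochastic and is the unique stochastic solution of the equation; (2) (supercritical case) if $\alpha>\frac12$, then $\mathbf 1_n^\top\mathbf m=\frac{1-\alpha}{\alpha}<1$ (so $\mathbf m$ is not stochastic), and there is at least one stochastic solution $\mathbf s$ of the equation, with $\mathbf s\ge\mathbf m$.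
   Context: $\mathbf 1_k$ denotes the column vector of all ones of length $k$; inequalities between vectors and matrices are componentwise; $\otimes$ is the Kronecker product. A vector $\mathbf s\in\mathbb R^n$ is stochastic if $\mathbf s\ge 0$ and $\mathbf 1_n^\top\mathbf s=1$. A minimal nonnegative solution is a solution $\mathbf m\ge 0$ such that $\mathbf m\le\mathbf x$ for every solution $\mathbf x\ge 0$. *)

(* Defs.v *)
From mathcomp Require Import all_boot all_order all_algebra.
From mathcomp Require Import reals.
From mathcomp Require Export mxtens.

Set Implicit Arguments.
Unset Strict Implicit.
Unset Printing Implicit Defensive.

Import Order.TTheory GRing.Theory Num.Theory.
Local Open Scope ring_scope.

Definition ones {K : realType} (k : nat) : 'cV[K]_k := const_mx 1.

(* The library puts no order on matrices, hence an explicit relation. *)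
Definition lemx (K : realType) (p q : nat) (A B : 'M[K]_(p, q)) : Prop :=
  forall i j, A i j <= B i j.

Definition stochastic (K : realType) (n : nat) (s : 'cV[K]_n) : Prop :=
  lemx 0 s /\ (ones n)^T *m s = 1%:M.

(* [x *t x] is the Kronecker product; its type ['M_(n * n, 1 * 1)] is
   convertible to ['cV_(n * n)]. *)
Definition pagerank_solution (K : realType) (n : nat) (alpha : K)
    (v : 'cV[K]_n) (R : 'M[K]_(n, n * n)) (x : 'cV[K]_n) : Prop :=
  x = alpha *: (R *m (x *t x)) + (1 - alpha) *: v.

Definition minimal_nonneg (K : realType) (n : nat) (P : 'cV[K]_n -> Prop)
    (m : 'cV[K]_n) : Prop :=
  [/\ P m, lemx 0 m & forall x, P x -> lemx 0 x -> lemx m x].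

(* Main.v *)
Require Import Defs.
From mathcomp Require Import all_boot all_order all_algebra.
From mathcomp Require Import reals.
From mathcomp Require Import zify lra ring.

Set Implicit Arguments.
Unset Strict Implicit.
Unset Printing Implicit Defensive.

Import Order.TTheory GRing.Theory Num.Theory.

(** Write [F x = alpha R (x *t x) + (1 - alpha) v] (this is [step]) and let the
    mass of a vector be the sum of its entries.  The map [F] is monotone on
    nonnegative vectors, and since the columns of [R] sum to 1 the mass of [F x]
    depends only on the mass [t] of [x]: it is [alpha t ^ 2 + (1 - alpha)], a
    scalar map whose fixed points are [1] and [(1 - alpha) / alpha].

    The iterates of [F] from 0 increase, stay below every nonnegative solution,
    and their masses stay below both scalar fixed points.  Their limit [m] is
    therefore the minimal solution ([minsol_minimal]), and its mass is the
    smaller of the two fixed points ([minsol_mass_sub], [minsol_mass_super]).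
    When [alpha <= 1/2] this mass is 1, and a stochastic solution, which
    dominates [m] and has the same mass, is equal to [m].

    When [alpha > 1/2], look for a stochastic solution of the form [m + r z] with
    [z] stochastic and [r = 1 - (1 - alpha) / alpha].  Expanding the quadratic
    term, [m + r z] is a solution as soon as
    [z = alpha (R (m *t z) + R (z *t m) + r R (z *t z))], and for this value
    of [r] the right-hand side maps the simplex to itself.  Brouwer's theorem
    provides the fixed point ([stochastic_above]).

    Brouwer's theorem on the simplex ([brouwer_simplex]) is derived from
    Scarf's combinatorial lemma ([scarf]), which replaces the triangulation in
    Sperner's argument by a family of linear orders, one for each coordinate.
    Applied to the points of the simplex with denominator [N], each coloured by
    a coordinate that the map does not decrease, it yields a cell of diameter at
    most [n / N] in which every colour occurs except for coordinates that are
    almost 0 on the cell ([grid_cell], [brouwer_approx]); compactness then gives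
    a point none of whose coordinates decreases, which is a fixed point. *)

(** * Scarf's lemma *)

Section Scarf.
(** The values [r i] rank the points of [X] in the order attached to [i].  The
    points [e i], called slack points, play the role of the facets of a simplex:
    [e i] is the least point for the order [i] and lies above all the proper
    points, those that are not slack, for the other orders.  With them all cells
    have [#|I|] points and all faces one point less, as in a triangulation. *)
Variables (I X : finType) (r : I -> X -> nat) (e : I -> X) (x0 : X).
Hypothesis r_inj : forall i, injective (r i).
Hypothesis e_least : forall i x, r i (e i) <= r i x.
Hypothesis e_big :
  forall i j x, j != i -> x \notin codom e -> r i x < r i (e j).
Hypothesis x0_proper : x0 \notin codom e.

(** No point lies strictly above all of [S] in every order at once.  The
    dominant sets of [#|I|] points are the cells of the triangulation. *)
Definition dominant (S : {set X}) :=
  [forall y, exists i, forall s in S, r i y <= r i s].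

Lemma dominantP (S : {set X}) :
  reflect (forall y, exists i, forall s, s \in S -> r i y <= r i s)
    (dominant S).
Proof.
apply: (iffP forallP) => H y; have := H y.
  by case/existsP=> i /forall_inP Hi; exists i.
by case=> i Hi; apply/existsP; exists i; apply/forall_inP.
Qed.

Lemma below_slack i x : r i x <= r i (e i) -> x \in codom e.
Proof.
move=> le; apply/codomP; exists i; apply: (@r_inj i).
by apply/eqP; rewrite eqn_leq le e_least.
Qed.

(** The boundary face of Sperner's argument, made of all slack points but
    [e i], lies in one cell only: the vertex completing it has to be the proper
    point that is largest for [i]. *)
Lemma slack_face_cells (i : I) :
  #|[set y | (y \notin e @: [set~ i]) && dominant (y |: e @: [set~ i])]| = 1.
Proof.
apply/eqP/cards1P.
pose P := [pred y | y \notin codom e].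
case: (@arg_maxnP _ x0 P (r i) x0_proper) => y Py ymax.
have slackT z j : j != i -> e j \in z |: e @: [set~ i].
  by move=> ji; rewrite !inE imset_f ?orbT // !inE.
exists y; apply/setP=> z; rewrite !inE.
apply/andP/eqP => [[zT /dominantP domz]|->].
  (* For [k] other than [i] the face contains the least point [e k], which is
     above no proper point: only the order [i] can witness dominance at [x]. *)
  have prop_i x : x \notin codom e -> r i x <= r i z.
    move=> xP; have [k Hk] := domz x; have [jk|njk] := eqVneq k i.
      by rewrite -jk; apply: Hk; rewrite !inE eqxx.
    by case/negP: xP; apply: (@below_slack k); apply: Hk; apply: slackT.
  have Pz : P z.
    apply/negP=> /codomP[j zj]; have [ij|nij] := eqVneq j i; last first.
      by move: zT; rewrite zj imset_f // !inE.
    case/negP: x0_proper; apply: (@below_slack i).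
    by rewrite -[in e i]ij -zj prop_i.
  apply: (@r_inj i); apply/eqP; rewrite eqn_leq prop_i // andbT.
  exact: ymax.
split.
  by apply/imsetP=> -[j _ yj]; move: Py; rewrite inE /= yj codom_f.
apply/dominantP=> w.
have [/codomP[j ->]|Pw] := boolP (w \in codom e).
  by exists j => s _; apply: e_least.
exists i => s; rewrite !inE => /orP[/eqP-> |]; first exact: ymax.
by move=> /imsetP[j]; rewrite !inE => ji ->; apply/ltnW/e_big.
Qed.

(** An interior face lies in 0 or 2 cells.  If [T] lies in a cell, sending [i] to
    the [i]-least point of [T] is a map [f] from [I] onto [T]; as [T] has one
    point less than [I], exactly two indices [a] and [b] have the same image.  A
    vertex completing [T] to a cell has to be the least one for one index [d],
    and the other indices must still reach all of [T], so [d] is [a] or [b]; the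
    vertex is then the [d]-largest point among those lying above [f i] in every
    other order [i]. *)
Lemma face_cells (T : {set X}) (t0 : X) :
  #|T|.+1 = #|I| -> t0 \in T -> t0 \notin codom e ->
  ~~ odd #|[set y | (y \notin T) && dominant (y |: T)]|.
Proof.
move=> cardT t0T t0P; set Rm := [set y | _].
have [->|[y0 y0R]] := set_0Vmem Rm; first by rewrite cards0.
have [f fP] : exists f : {ffun I -> X},
    forall i, f i \in T /\ (forall t, t \in T -> r i (f i) <= r i t).
  exists [ffun i => [arg min_(t < t0 in T) r i t]] => i; rewrite ffunE.
  by case: arg_minnP.
have fT i : f i \in T by case: (fP i).
have fmin i t : t \in T -> r i (f i) <= r i t by case: (fP i) => _; apply.
have fE i t : t \in T -> (forall s, s \in T -> r i t <= r i s) -> f i = t.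
  move=> tT tm; apply: (@r_inj i); apply/eqP.
  by rewrite eqn_leq fmin // tm.
have domT : dominant T.
  move: y0R; rewrite inE => /andP[_ /dominantP dom]; apply/dominantP=> z.
  by have [i Hi] := dom z; exists i => s sT; apply: Hi; rewrite !inE sT orbT.
have onto t : t \in T -> exists i, f i = t.
  by move=> tT; have /dominantP/(_ t)[i Hi] := domT; exists i; apply: fE.
have cardC (d : I) : #|[set~ d]| = #|T|.
  by rewrite cardsC1 -cardT.
have [a [b [ab fab]]] : exists a b, a != b /\ f a = f b.
  have [finj|/injectivePn[a [b nab fab]]] := boolP (injectiveb f).
    have /subset_leq_card : f @: setT \subset T.
      by apply/subsetP=> _ /imsetP[i _ ->].
    by rewrite card_imset ?cardsT -?cardT ?ltnn //; apply/injectiveP.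
  by exists a, b.
have f_inj d : f @: [set~ d] = T -> {in [set~ d] &, injective f}.
  by move=> fd; apply/imset_injP; rewrite fd cardC.
have f_onto d d' : d != d' -> f d = f d' -> f @: [set~ d] = T.
  move=> dd' fdd'; apply/setP=> t; apply/imsetP/idP=> [[i _ ->] //|tT].
  have [i fi] := onto t tT; have [id|nid] := eqVneq i d.
    by exists d'; rewrite ?inE 1?eq_sym // -fdd' -id fi.
  by exists i; rewrite // !inE.
have f_only d : f @: [set~ d] = T -> d \in [set a; b].
  move=> fd; apply/negPn/negP; rewrite !inE negb_or => /andP[da db].
  by move/negP: ab; apply; apply/eqP/(f_inj d fd); rewrite // !inE eq_sym.
(* Candidates for the new vertex when it takes over the index [d].  A proper
   point [t0] in [T] keeps all the [f i] below [e d], so there is always one. *)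
pose M d := [pred y | [forall i, (i != d) ==> (r i (f i) < r i y)]].
have MP d y : reflect (forall i, i != d -> r i (f i) < r i y) (M d y).
  by apply: (iffP forall_inP).
have Me d : M d (e d).
  apply/MP=> i id; apply: leq_ltn_trans (fmin i _ t0T) _.
  by apply: e_big; rewrite // eq_sym.
have [g gP] : exists g : I -> X,
    forall d, M d (g d) /\ (forall y, M d y -> r d y <= r d (g d)).
  exists (fun d => [arg max_(y > e d | M d y) r d y]) => d.
  by case: arg_maxnP => [|y My ymax]; [apply: Me | split].
have gM d := (gP d).1; have gmax d := (gP d).2.
have g_low d t : t \in T -> r d (g d) <= r d t.
  have /dominantP/(_ (g d))[i Hi] := domT; have [id|nid] := eqVneq i d.
    by subst i; apply: Hi.
  by have /MP/(_ i nid) := gM d; rewrite ltnNge Hi.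
suff -> : Rm = [set g d | d in [set a; b]].
  rewrite imsetU1 imset_set1 cards2; suff -> : g a != g b by [].
  apply/eqP=> gab; have /MP/(_ b) := gM a; rewrite eq_sym => /(_ ab).
  by rewrite ltnNge gab g_low.
apply/setP=> y; rewrite inE.
apply/andP/imsetP => [[yT /dominantP dom]|[d dab ->]].
  have yyT : y \in y |: T by rewrite !inE eqxx.
  have tyT t : t \in T -> t \in y |: T by move=> tT; rewrite !inE tT orbT.
  have [d Hd] := dom y.
  have mind t : t \in T -> exists2 i, i != d &
      f i = t /\ r i t < r i y.
    move=> tT; have [i Hi] := dom t.
    have lti : r i t < r i y.
      rewrite ltn_neqAle Hi // andbT; apply/eqP=> /r_inj tyE.
      by move: yT; rewrite -tyE tT.
    exists i; last by split=> //; apply: fE => // s sT; apply: Hi; apply: tyT.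
    by apply: contraTneq lti => ->; rewrite -leqNgt Hd // tyT.
  have fd : f @: [set~ d] = T.
    apply/setP=> t; apply/imsetP/idP=> [[i _ ->] //|tT].
    by have [i id [fi _]] := mind t tT; exists i; rewrite // !inE.
  have My : M d y.
    apply/MP=> i id; have [j jd [fji ltj]] := mind (f i) (fT i).
    have <- : j = i by apply: (f_inj d fd); rewrite ?inE.
    by rewrite fji.
  exists d; first exact: f_only.
  apply: (@r_inj d); apply/eqP; rewrite eqn_leq gmax //=.
  have [i Hi] := dom (g d).
  have [id|nid] := eqVneq i d; first by subst i; apply: Hi.
  by have /MP/(_ i nid) := gM d; rewrite ltnNge Hi // tyT.
have fd : f @: [set~ d] = T.
  move: dab; rewrite !inE => /orP[] /eqP->; first exact: (f_onto a b).
  by apply: (f_onto b a); rewrite 1?eq_sym.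
split.
  rewrite -[T]fd; apply/imsetP=> -[i]; rewrite !inE => id gi.
  by have /MP/(_ i id) := gM d; rewrite gi ltnn.
apply/dominantP=> z; have [/gmax zd|/forallPn[i]] := boolP (M d z).
  exists d => s; rewrite !inE => /orP[/eqP-> //|sT].
  exact: leq_trans zd (g_low d s sT).
rewrite negb_imply -leqNgt => /andP[id zi].
exists i => s; rewrite !inE => /orP[/eqP->|sT].
  by apply: leq_trans zi _; apply/ltnW; have /MP := gM d; apply.
exact: leq_trans zi (fmin i s sT).
Qed.

Variable c : X -> I.
Hypothesis c_slack : forall i, c (e i) = i.

(** In a cell that misses a colour, the faces carrying exactly the colours other
    than [i] come in a pair: if there is one, [i] is the missing colour, and the
    two faces omit either of the two vertices that share a colour. *)
Lemma cell_faces (i : I) (S : {set X}) : #|S| = #|I| -> c @: S != setT ->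
  ~~ odd #|[set y in S | c @: (S :\ y) == [set~ i]]|.
Proof.
move=> cardS ncS; set D := [set y in S | _].
have [->|[y0]] := set_0Vmem D; first by rewrite cards0.
rewrite inE => /andP[y0S /eqP cy0].
have cS : c @: S = [set~ i].
  rewrite -(setD1K y0S) imsetU1 cy0; apply/setUidPr; rewrite sub1set !inE.
  apply: contraNneq ncS => ciy; rewrite -(setD1K y0S) imsetU1 cy0 ciy.
  by apply/eqP/setP=> j; rewrite !inE; case: eqP.
have inj y : c @: (S :\ y) = [set~ i] -> y \in S -> {in S :\ y &, injective c}.
  move=> cy yS; apply/imset_injP; rewrite cy cardsC1 -cardS.
  by rewrite (cardsD1 y S) yS.
have : c y0 \in c @: (S :\ y0) by rewrite cy0 -cS imset_f.
case/imsetP=> y1 /setD1P[y10 y1S] c01.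
suff -> : D = [set y0; y1] by rewrite cards2 eq_sym y10.
apply/setP=> y; rewrite !inE; apply/andP/orP => [[yS /eqP cy]|[]/eqP->].
- have [->|n0] := eqVneq y y0; [by left|right]; apply: contraNT y10 => n1.
  by apply/eqP/(inj y cy yS) => //; rewrite !inE 1?eq_sym ?n0 ?n1.
- by rewrite y0S cy0.
- rewrite y1S; split=> //; apply/eqP/setP=> j; rewrite -cS.
  apply/imsetP/imsetP => -[s sS ->].
    by move/setD1P: sS => [_ sS]; exists s.
  have [->|n1] := eqVneq s y1; last by exists s; rewrite // !inE n1.
  by exists y0; rewrite // !inE eq_sym y10.
Qed.

(** Count the incidences between cells and faces carrying exactly the colours
    other than some fixed [i].  Without a cell of all colours the count is even
    by [cell_faces]; counted by faces it is odd, since the only such face without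
    proper points is the boundary face, which lies in one cell, and every other
    one lies in an even number of cells by [face_cells]. *)
Theorem scarf : exists2 S : {set X}, dominant S & c @: S = setT.
Proof.
pose i := c x0.
pose Q (T : {set X}) := (#|T|.+1 == #|I|) && (c @: T == [set~ i]).
have [/existsP[S /andP[dS /eqP cS]]|none] :=
  boolP [exists S : {set X}, dominant S && (c @: S == setT)]; first by exists S.
have sum_even (A : finType) (P : pred A) (F : A -> nat) :
    (forall k, P k -> ~~ odd (F k)) -> ~~ odd (\sum_(k | P k) F k).
  by move=> FP; elim/big_ind: _ => // m k; rewrite oddD => /negbTE-> /negbTE->.
have count (A : finType) (P : pred A) : \sum_(k | P k) 1 = #|[set k | P k]|.
  by rewrite sum1_card cardsE.
have even : ~~ odd (\sum_(S : {set X})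
    \sum_(y | [&& y \in S, Q (S :\ y) & dominant S]) 1).
  apply: sum_even => S _; rewrite count.
  have [dS|_] := boolP (dominant S); last first.
    rewrite (_ : [set _ | _] = set0) ?cards0 //.
    by apply/setP=> y; rewrite !inE !andbF.
  have ncS : c @: S != setT.
    by apply: contraNneq none => cS; apply/existsP; exists S; rewrite dS cS /=.
  have [cardS|ncardS] := eqVneq #|S| #|I|; last first.
    rewrite (_ : [set _ | _] = set0) ?cards0 //; apply/setP=> y; rewrite !inE.
    apply: contraNF ncardS => /and3P[yS /andP[/eqP cQ _] _].
    by rewrite -cQ (cardsD1 y S) yS.
  rewrite (_ : [set _ | _] = [set y in S | c @: (S :\ y) == [set~ i]]).
    exact: cell_faces.
  apply/setP=> y; rewrite !inE andbT /Q; have [yS|//] := boolP (y \in S).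
  by rewrite -cardS (cardsD1 y S) yS eqxx.
case/negP: even.
(* Index an incidence by the face [T] and the vertex [y] completing it. *)
rewrite (exchange_big_dep xpredT) //=.
under eq_bigr => y _.
  rewrite (reindex_onto (fun T => y |: T) (fun S => S :\ y)) /=; last first.
    by move=> S /and3P[yS _ _]; rewrite setD1K.
  rewrite (eq_bigl (fun T : {set X} =>
    Q T && ((y \notin T) && dominant (y |: T)))); last first.
    move=> T; rewrite setU11 /=; have [yT|yT] := boolP (y \in T).
      rewrite andbF; apply/negbTE; rewrite negb_and; apply/orP; right.
      by apply: contraTneq yT => <-; rewrite !inE eqxx.
    by rewrite setU1K // eqxx andbT.
  over.
rewrite (exchange_big_dep Q) /=; last by move=> y T _ /andP[].
have e_inj : injective e by apply: can_inj c_slack.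
have QT0 : Q (e @: [set~ i]).
  rewrite /Q card_imset // cardsC1 prednK; last by apply/card_gt0P; exists i.
  rewrite eqxx -imset_comp; apply/eqP/setP=> j.
  apply/imsetP/idP=> [[k ki ->]|ji].
    by rewrite /= c_slack.
  by exists j; rewrite //= c_slack.
rewrite (bigD1 (e @: [set~ i])) //= oddD.
rewrite (eq_bigl (fun y => (y \notin e @: [set~ i]) &&
  dominant (y |: e @: [set~ i]))); last first.
  by move=> y; rewrite QT0.
rewrite count slack_face_cells /=; apply: sum_even => T /andP[QT nT0].
rewrite (eq_bigl (fun y => (y \notin T) && dominant (y |: T))); last first.
  by move=> y; rewrite QT.
have /andP[/eqP cardT /eqP cT] := QT.
have [/exists_inP[t tT tP]|] := boolP [exists t in T, t \notin codom e].
  by rewrite count; apply: face_cells tP.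
rewrite negb_exists_in => /forall_inP slackT.
case/negP: nT0; rewrite eqEcard.
rewrite -(leq_add2l 1) !add1n cardT; have /andP[/eqP-> _] := QT0.
rewrite leqnn andbT; apply/subsetP=> t tT.
have /negPn/codomP[j tj] := slackT t tT; rewrite tj imset_f //.
by rewrite -cT -(c_slack j) -tj imset_f.
Qed.

End Scarf.

(** Scarf's lemma without slack points: [C] consists of the indices whose slack
    point is not a vertex of the cell.  Ties between the values [p i] are broken
    by an enumeration of [P], and the slack points are adjoined by a disjoint
    union. *)
Theorem scarf_points (I P : finType) (p : I -> P -> nat) (c : P -> I) (x0 : P) :
  exists (C : {set I}) (S : {set P}),
    (forall i, i \in C -> exists2 x, x \in S & c x = i) /\
    (forall y, exists2 i, i \in C & forall x, x \in S -> p i y <= p i x).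
Proof.
pose rk i x := (p i x * #|P| + enum_rank x).+1.
have rk_le i x y : rk i x <= rk i y -> p i x <= p i y.
  rewrite /rk ltnS; apply: contraTT; rewrite -!ltnNge => lt.
  have : (p i y).+1 * #|P| <= p i x * #|P| by rewrite leq_mul2r lt orbT.
  rewrite mulSnr => /(leq_trans _) le; apply: leq_trans (leq_addr _ _).
  by apply: le; rewrite ltn_add2l.
have rk_inj i : injective (rk i).
  move=> x y /succn_inj eq; apply: enum_rank_inj; apply: val_inj => /=.
  by have := congr1 (modn^~ #|P|) eq; rewrite !modnMDl !modn_small.
pose B i := \sum_x (rk i x).+1.
have rkB i x : rk i x < B i by rewrite /B (bigD1 x) //= leq_addr.
pose r i (s : I + P) := match s with
  | inl j => if j == i then 0 else B i + enum_rank j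
  | inr x => rk i x end.
have r_inj i : injective (r i).
  move=> [j|x] [k|y] //=.
  - case: eqP => [->|_]; case: eqP => [->|_] //.
    + by have := rkB i x0; lia.
    + by have := rkB i x0; lia.
    + by move/addnI => /val_inj /enum_rank_inj ->.
  - by have := rkB i y; case: eqP => // _; lia.
  - by have := rkB i x; case: eqP => // _; lia.
  - by move/rk_inj->.
have proper x : (inr x : I + P) \notin codom (@inl I P).
  by apply/codomP=> -[].
have least i s : r i (inl i) <= r i s by rewrite /= eqxx.
have big i j s : j != i -> s \notin codom (@inl I P) -> r i s < r i (inl j).
  case: s => [k /= _|x /= /negbTE-> _]; first by rewrite codom_f.
  by have := rkB i x; lia.
pose c' (s : I + P) := match s with inl j => j | inr x => c x end.
have [//|S /dominantP dS cS] :=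
  @scarf _ _ r inl (inr x0) r_inj least big (proper x0) c'.
exists [set i | inl i \notin S], [set x | inr x \in S]; split.
  move=> i; rewrite inE => iS; have : i \in c' @: S by rewrite cS.
  case/imsetP=> -[j|x] sS ijx; last by exists x; rewrite // inE.
  by case/negP: iS; rewrite ijx.
move=> y; have [i Hi] := dS (inr y); exists i.
  by rewrite inE; apply/negP=> /Hi; rewrite /= eqxx.
by move=> x; rewrite inE => /Hi /rk_le.
Qed.

(** * Small cells in a grid on the simplex *)

Definition grid n N := [set x : {ffun 'I_n -> 'I_N.+1} | \sum_i x i == N].

Lemma grid_point n N (g : 'I_n -> nat) : \sum_i g i = N ->
  exists2 x, x \in grid n N & forall i, x i = g i :> nat.
Proof.
move=> sg; have xE i : [ffun i => inord (g i) : 'I_N.+1] i = g i :> nat.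
  by rewrite ffunE inordK // ltnS -sg (bigD1 i) //= leq_addr.
exists [ffun i => inord (g i)] => //; rewrite inE -[X in _ == X]sg.
by apply/eqP/eq_bigr => i _; apply: xE.
Qed.

(** With [m i] the least [i]-coordinate over the cell if [i] is in [C] and 0
    otherwise, no grid point exceeds [m i] at all [i] in [C].  Such a point would
    exist if the numbers [m i + 1], for [i] in [C], had a sum of at most [N];
    hence the sum of [m] is larger than [N - n], and every vertex, lying above
    [m] and having sum [N], is within [n] of [m]. *)
Theorem grid_cell n N (c : {ffun 'I_n -> 'I_N.+1} -> 'I_n) :
  exists m : 'I_n -> nat,
    let close (x : {ffun 'I_n -> 'I_N.+1}) :=
      x \in grid n N /\ forall i, m i <= x i <= m i + n in
    (exists x, close x) /\ (forall i, m i = 0 \/ exists2 x, close x & c x = i).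
Proof.
pose i0 := c [ffun=> ord0].
have sum_if (C : {set 'I_n}) i (d : nat) (g : 'I_n -> nat) : i \in C ->
    \sum_j (if j \in C then g j + (j == i) * d else 0) = \sum_(j in C) g j + d.
  move=> iC; rewrite -big_mkcond /= big_split /=; congr (_ + _).
  rewrite (bigD1 i) //= eqxx mul1n big1 ?addn0 // => j /andP[_ /negbTE->].
  by rewrite mul0n.
have [z0 z0G _] :
  exists2 x, x \in grid n N & forall i, x i = (i == i0) * N :> nat.
  apply: grid_point; rewrite (bigD1 i0) //= eqxx mul1n big1 ?addn0 //.
  by move=> j /negbTE->; rewrite mul0n.
pose P := {x | x \in grid n N}.
have [C [S [CS dom]]] := @scarf_points 'I_n P (fun i x => val x i)
  (fun x => c (val x)) (exist _ z0 z0G).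
have [i1 i1C _] := dom (exist _ z0 z0G); have [x1 x1S _] := CS i1 i1C.
have [m0 m0P] : exists m0 : 'I_n -> P, forall i,
    m0 i \in S /\ (forall x, x \in S -> val (m0 i) i <= val x i).
  exists (fun i => [arg min_(x < x1 in S) val x i]) => i.
  by case: arg_minnP.
pose m i := if i \in C then val (m0 i) i : nat else 0.
have m_le i x : x \in S -> m i <= val x i.
  by rewrite /m; case: ifP => // _; apply: (m0P i).2.
have sum_m : N < \sum_i m i + n.
  apply: (@leq_trans (\sum_(i in C) (m i).+1)); last first.
    rewrite -[X in _ + X]card_ord -sum1_card -big_split /= big_mkcond /=.
    by apply: leq_sum => i _; rewrite addn1; case: ifP.
  rewrite ltnNge; apply/negP=> le.
  (* The point with coordinates [m i + 1] on [C], the excess being put at [i1]. *)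
  have [y yG yE] := grid_point
    (etrans (sum_if C i1 (N - _) (fun i => (m i).+1) i1C) (subnKC le)).
  have [i iC Hi] := dom (exist _ y yG).
  have := Hi (m0 i) (m0P i).1; rewrite /= yE iC /m iC /=; lia.
have Sclose x : x \in S ->
    val x \in grid n N /\ forall i, m i <= val x i <= m i + n.
  move=> xS; split=> [|i]; first exact: valP.
  rewrite m_le //=; have := valP x; rewrite inE => /eqP sx.
  move: sum_m; rewrite -{1}sx (bigD1 i) //= (bigD1 i (F := m)) //=.
  have le_rest : \sum_(j | j != i) m j <= \sum_(j | j != i) val x j.
    by apply: leq_sum => j _; apply: m_le.
  have arith a b d k : a + b < d + k + n -> k <= b -> a <= d + n by lia.
  by move/arith; apply.
exists m => close; split; first by exists (val x1); apply: Sclose.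
move=> i; rewrite {1}/m; case: ifP => [iC|_]; [right|by left].
by have [x xS cx] := CS i iC; exists (val x) => //; apply: Sclose.
Qed.

(** * Brouwer's theorem on the simplex *)

From mathcomp Require Import boolp classical_sets topology normedtype sequences.
Import numFieldTopology.Exports numFieldNormedType.Exports.
Local Open Scope ring_scope.

Lemma le_sum_eq (K : realType) (n : nat) (a b : 'I_n -> K) :
  (forall i, a i <= b i) -> \sum_i a i = \sum_i b i -> a =1 b.
Proof.
move=> le sab i; apply/esym/eqP; rewrite -subr_eq0; apply/eqP.
have : \sum_j (b j - a j) = 0 by rewrite sumrB sab subrr.
by move/psumr_eq0P => -> // j _; rewrite subr_ge0.
Qed.

Section Brouwer.
Variables (K : realType) (n : nat).

Definition simplex : set 'rV[K]_n :=
  [set x | (forall i, 0 <= x 0 i) /\ \sum_i x 0 i = 1]%classic.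

Lemma simplex_compact : compact simplex.
Proof.
pose cube := [set x : 'rV[K]_n | forall i, `[0, 1]%classic (x 0 i)]%classic.
have cubeK : compact cube.
  apply: (@rV_compact K n (fun=> `[0, 1]%classic)) => i.
  exact: segment_compact.
apply: subclosed_compact cubeK _; last first.
  move=> x [x0 x1] i; rewrite /= in_itv /= x0 -x1 (bigD1 i) //= lerDl.
  exact: sumr_ge0.
have -> : simplex = ((\bigcap_i [set x : 'rV[K]_n | 0 <= x 0 i]) `&`
    (fun x : 'rV[K]_n => \sum_i x 0 i) @^-1` [set 1])%classic.
  by apply/seteqP; split=> x /= [x0 x1]; split=> // i; [move=> _|]; apply: x0.
apply: closedI.
  apply: closed_bigI => i _.
  apply: (@preimage_closed _ _ (fun x : 'rV[K]_n => x 0 i)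
    [set t | 0 <= t]%classic).
    by move=> x _; apply: coord_continuous.
  exact: closed_ge.
apply: (@preimage_closed _ _ (fun x : 'rV[K]_n => \sum_i x 0 i)
  [set 1]%classic); last exact: closed_eq.
move=> x _; apply: continuous_big => [|i _]; [exact: add_continuous|].
exact: coord_continuous.
Qed.

Lemma simplex_le_eq (x y : 'rV[K]_n) : simplex x -> simplex y ->
  (forall i, x 0 i <= y 0 i) -> x = y.
Proof.
by move=> [_ sx] [_ sy] le; apply/rowP/le_sum_eq => //; rewrite sx sy.
Qed.

Variable f : 'rV[K]_n -> 'rV[K]_n.
Hypothesis f_simplex : forall x, simplex x -> simplex (f x).

(** Every row of the simplex has a coordinate that [f] does not decrease, since
    the sum of the coordinates is preserved; it serves as the colour. *)
Lemma brouwer_approx (d : K) : (0 < n)%N -> 0 < d ->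
  exists2 p : 'rV[K]_n, simplex p & forall i, p 0 i <= d \/
    exists x : 'rV[K]_n,
      [/\ simplex x, x 0 i <= f x 0 i & forall j, `|p 0 j - x 0 j| <= d].
Proof.
move=> n0 d0; pose N := (Num.truncn (n%:R / d)).+1.
have N0 : 0 < N%:R :> K by rewrite ltr0n.
have Nd : n%:R / N%:R <= d.
  by rewrite ler_pdivrMr // mulrC -ler_pdivrMr // ltW // truncnS_gt.
pose pt (x : {ffun 'I_n -> 'I_N.+1}) : 'rV[K]_n := \row_i ((x i)%:R / N%:R).
have ptP x : x \in grid n N -> simplex (pt x).
  rewrite inE => /eqP sx; split=> [i|]; first by rewrite mxE divr_ge0.
  under eq_bigr do rewrite mxE.
  by rewrite -mulr_suml -natr_sum sx divff // gt_eqF.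
pose c x := odflt (Ordinal n0) [pick i | pt x 0 i <= f (pt x) 0 i].
have cP x : x \in grid n N -> pt x 0 (c x) <= f (pt x) 0 (c x).
  move=> /ptP xS; rewrite /c; case: pickP => [i //|none].
  have fxS := f_simplex xS.
  have := none (Ordinal n0); rewrite (simplex_le_eq fxS xS) ?lexx // => i.
  by rewrite ltW // ltNge none.
have [m /= [[x0 [x0G x0m]] mP]] := grid_cell c.
exists (pt x0); first exact: ptP.
move=> i; case: (mP i) => [m0|[x [xG xm] cx]]; [left|right].
  apply: le_trans Nd; rewrite mxE ler_pM2r ?invr_gt0 // ler_nat.
  by have := x0m i; rewrite m0 add0n.
exists (pt x); split; [exact: ptP | by rewrite -cx cP |] => j.
apply: le_trans Nd; rewrite !mxE -mulrBl normrM.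
rewrite [X in _ * X]ger0_norm ?invr_ge0 ?ler0n //.
rewrite ler_pM2r ?invr_gt0 //.
have := x0m j; have := xm j; move: (x0 j : nat) (x j : nat) => a b Hb Ha.
have [|] := leqP a b => ab.
  by rewrite distrC -natrB // normr_nat ler_nat; lia.
by rewrite -natrB 1?ltnW // normr_nat ler_nat; lia.
Qed.

Hypothesis f_cont : forall i, continuous (fun x => f x 0 i).

(** A cluster point [p] of approximate solutions satisfies [p i <= f p i] for all
    [i].  Otherwise [p i > f p i >= 0], and near [p] every point [x] has
    [f x i < x i] and [x i] bounded away from 0, which excludes both
    alternatives of [brouwer_approx]. *)
Theorem brouwer_simplex :
  (0 < n)%N -> exists2 x : 'rV[K]_n, simplex x & f x = x.
Proof.
move=> n0.
have /choice[q qP] : forall k, exists p : 'rV[K]_n, simplex p /\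
    forall i, p 0 i <= k.+1%:R^-1 \/ exists x : 'rV[K]_n,
      [/\ simplex x, x 0 i <= f x 0 i &
          forall j, `|p 0 j - x 0 j| <= k.+1%:R^-1].
  move=> k; have k0 : 0 < k.+1%:R^-1 :> K by rewrite invr_gt0 ltr0n.
  by have [p pS pP] := brouwer_approx n0 k0; exists p.
have [p [pS pcl]] : (simplex `&` cluster (q @ \oo) !=set0)%classic.
  by apply: simplex_compact; exists 0%N => // k _; apply: (qP k).1.
suff le i : p 0 i <= f p 0 i.
  by exists p => //; apply/esym/simplex_le_eq => //; apply: f_simplex.
rewrite leNgt; apply/negP=> lt.
have fp0 : 0 <= f p 0 i by apply: (f_simplex pS).1.
have : nbhs p [set x : 'rV[K]_n | f x 0 i < x 0 i]%classic.
  have : ((x : 'rV[K]_n) 0 i - f x 0 i @[x --> p] --> p 0 i - f p 0 i)%classic.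
    apply: cvgB; [exact: nbhs_filter | exact: (@coord_continuous K 1 n 0 i) |].
    exact: f_cont.
  move/cvgr_gt => /(_ 0); rewrite subr_gt0 => /(_ lt).
  by apply: filterS => x; rewrite /= subr_gt0.
move=> /nbhs_ballP[e e0 be].
(* If [q k] is within [d] of [p], then points within [d] of [q k] stay in the
   ball of radius [e], and [q k 0 i] cannot be at most [d]. *)
pose d := Num.min e (p 0 i) / 2.
have d0 : 0 < d by rewrite divr_gt0 // lt_min e0 (le_lt_trans fp0 lt).
have [de dp] : d + d <= e /\ d + d <= p 0 i.
  by rewrite -splitr !ge_min !lexx orbT.
have [k0 k0d] : exists k0, forall k, (k0 <= k)%N -> k.+1%:R^-1 <= d.
  exists (Num.truncn d^-1) => k k0k; rewrite invf_ple ?posrE ?ltr0n //.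
  by apply/ltW/(lt_le_trans (truncnS_gt _)); rewrite ler_nat.
have [_ [[k k0k <-] pk]] :
  ([set q k | k in [set k | (k0 <= k)%N]] `&` ball p d !=set0)%classic.
  apply: pcl; last exact: nbhsx_ballx.
  by exists k0 => // k k0k; exists k.
have [_ /(_ i)] := qP k.
have {}pk j : `|p 0 j - q k 0 j| < d by apply: pk.2.
case=> [qk|[x [xS xf /(_ _)/le_trans/(_ (k0d k k0k)) xq]]].
  have := le_trans qk (k0d k k0k); have := ler_norm (p 0 i - q k 0 i).
  have := pk i; lra.
have : ball p e x.
  split=> // a j; rewrite (ord1 a).
  rewrite /ball /= -(subrK (q k 0 j) (p 0 j)) -addrA.
  apply: le_lt_trans (ler_normD _ _) _; apply: lt_le_trans de.
  exact: ltr_leD.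
by move/be => /=; rewrite ltNge xf.
Qed.

End Brouwer.

(** * The minimal nonnegative solution *)

Section PageRank.
Variables (K : realType) (n : nat).

Definition mass (x : 'cV[K]_n) : K := \sum_i x i 0.

Lemma mul_ones (x : 'cV[K]_n) : (ones n)^T *m x = (mass x)%:M.
Proof.
apply/matrixP=> i j; rewrite !ord1 !mxE eqxx mulr1n.
by apply: eq_bigr => k _; rewrite !mxE mul1r.
Qed.

Lemma mul_ones_eq (x : 'cV[K]_n) (a : K) :
  (ones n)^T *m x = a%:M <-> mass x = a.
Proof.
rewrite mul_ones; split=> [|->//] /matrixP/(_ 0 0).
by rewrite !mxE eqxx !mulr1n.
Qed.

Lemma lemx_mass_eq (x y : 'cV[K]_n) : lemx x y -> mass x = mass y -> x = y.
Proof. by move=> le sxy; apply/colP/le_sum_eq. Qed.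

Let coord_ge0 (x : 'cV[K]_n) i : lemx 0 x -> 0 <= x i 0.
Proof. by move=> /(_ i 0); rewrite mxE. Qed.

Let coordD (x y : 'cV[K]_n) i : (x + y) i 0 = x i 0 + y i 0.
Proof. by rewrite mxE. Qed.

Let coordZ a (x : 'cV[K]_n) i : (a *: x) i 0 = a * x i 0.
Proof. by rewrite mxE. Qed.

Lemma coord_le_mass (x : 'cV[K]_n) i : lemx 0 x -> x i 0 <= mass x.
Proof.
move=> x0; rewrite /mass (bigD1 i) //= lerDl sumr_ge0 // => j _.
exact: coord_ge0.
Qed.

Variables (alpha : K) (v : 'cV[K]_n) (R : 'M[K]_(n, n * n)).
Hypotheses (alpha_gt0 : 0 < alpha) (alpha_lt1 : alpha < 1).
Hypotheses (v_ge0 : lemx 0 v) (v_mass : mass v = 1).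
Hypotheses (R_ge0 : lemx 0 R) (R_sum1 : forall k, \sum_i R i k = 1).

Definition bil (x y : 'cV[K]_n) : 'cV[K]_n := R *m (x *t y).

Lemma bilE x y i : bil x y i 0 = \sum_k R i k *
  (x (mxtens_unindex k).1 0 * y (mxtens_unindex k).2 0).
Proof.
by rewrite mxE; apply: eq_bigr => k _; rewrite /tensmx mxE !ord1.
Qed.

Lemma bil_mass x y : mass (bil x y) = mass x * mass y.
Proof.
rewrite /mass mulr_sum; under eq_bigr do rewrite bilE.
by rewrite exchange_big; apply: eq_bigr => k _; rewrite -mulr_suml R_sum1 mul1r.
Qed.

Lemma bil_le x y x' y' : lemx 0 x -> lemx x x' -> lemx 0 y -> lemx y y' ->
  lemx (bil x y) (bil x' y').
Proof.
move=> x0 xx' y0 yy' i j; rewrite ord1 !bilE; apply: ler_sum => k _.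
apply: ler_wpM2l; first by have := R_ge0 i k; rewrite mxE.
by apply: ler_pM => //; apply: coord_ge0.
Qed.

Lemma bil_ge0 x y : lemx 0 x -> lemx 0 y -> lemx 0 (bil x y).
Proof.
move=> x0 y0 i j; rewrite mxE ord1 bilE sumr_ge0 // => k _.
by rewrite !mulr_ge0 ?coord_ge0 //; have := R_ge0 i k; rewrite mxE.
Qed.

Lemma bil_shift x z (r : K) : bil (x + r *: z) (x + r *: z) =
  bil x x + r *: (bil x z + bil z x + r *: bil z z).
Proof.
apply/colP=> i; rewrite !(coordD, coordZ) !bilE.
rewrite !mulr_sumr -!big_split /= !mulr_sumr -big_split /=.
by apply: eq_bigr => k _; rewrite !(coordD, coordZ); ring.
Qed.

Lemma bil_cvg (T : Type) (F : set_system T) (x y : T -> 'cV[K]_n)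
    (a b : 'cV[K]_n) i : Filter F ->
  (forall j, x t j 0 @[t --> F] --> a j 0)%classic ->
  (forall j, y t j 0 @[t --> F] --> b j 0)%classic ->
  (bil (x t) (y t) i 0 @[t --> F] --> bil a b i 0)%classic.
Proof.
move=> FF xa yb; rewrite bilE.
under eq_cvg do rewrite bilE.
apply: cvg_big => [|k _]; first exact: add_continuous.
by apply: cvgM; [exact: cvg_cst | apply: cvgM].
Qed.

Definition step x : 'cV[K]_n := alpha *: bil x x + (1 - alpha) *: v.

Lemma step_mass x : mass (step x) = alpha * mass x ^+ 2 + (1 - alpha).
Proof.
have -> : 1 - alpha = (1 - alpha) * mass v by rewrite v_mass mulr1.
rewrite expr2 -bil_mass /mass !mulr_sumr -big_split /=.
by apply: eq_bigr => i _; rewrite !mxE.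
Qed.

Lemma step_le x y : lemx 0 x -> lemx x y -> lemx (step x) (step y).
Proof.
move=> x0 xy i j; rewrite !mxE lerD2r ler_pM2l //.
by have := bil_le x0 xy x0 xy i j; rewrite !mxE.
Qed.

Lemma step_ge0 x : lemx 0 x -> lemx 0 (step x).
Proof.
move=> x0 i j; have := bil_ge0 x0 x0 i j; have := v_ge0 i j.
rewrite !ord1 !mxE => ? ?.
by rewrite addr_ge0 // mulr_ge0 // ?subr_ge0 ltW.
Qed.

Definition iterate k := iter k step 0.

Lemma iterate_ge0 k : lemx 0 (iterate k).
Proof. by elim: k => [|k IH] /=; [move=> i j | apply: step_ge0]. Qed.

Lemma iterate_leS k : lemx (iterate k) (iterate k.+1).
Proof.
elim: k => [|k IH]; first exact: iterate_ge0.
by apply: step_le => //; apply: iterate_ge0.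
Qed.

Lemma iterate_le_solution x k : pagerank_solution alpha v R x -> lemx 0 x ->
  lemx (iterate k) x.
Proof.
move=> xsol x0; elim: k => [//|k IH]; rewrite xsol.
by apply: step_le => //; apply: iterate_ge0.
Qed.

(** The scalar map [t |-> alpha t ^ 2 + (1 - alpha)] increases on [t >= 0], so
    iterating it from 0 never passes a fixed point [c]. *)
Lemma iterate_mass c k : 0 <= c -> c = alpha * c ^+ 2 + (1 - alpha) ->
  mass (iterate k) <= c.
Proof.
move=> c0 cE; elim: k => [|k IH].
  by rewrite /mass big1 // => i _; rewrite mxE.
rewrite step_mass cE lerD2r ler_pM2l // lerXn2r ?nnegrE //.
by apply: sumr_ge0 => i _; apply/coord_ge0/iterate_ge0.
Qed.

Definition minsol : 'cV[K]_n := \col_i sup (range (fun k => iterate k i 0)).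

Lemma iterate_cvg i : (iterate k i 0 @[k --> \oo] --> minsol i 0)%classic.
Proof.
rewrite mxE; apply: nondecreasing_cvgn.
  by apply/nondecreasing_seqP => k; apply: iterate_leS.
exists 1 => _ [k _ <-]; apply: le_trans (coord_le_mass i (@iterate_ge0 k)) _.
by apply: iterate_mass => //; lra.
Qed.

Lemma minsol_fixed : pagerank_solution alpha v R minsol.
Proof.
apply/colP=> i.
have to_min : (iterate k.+1 i 0 @[k --> \oo] --> minsol i 0)%classic.
  by rewrite (cvg_shiftS (fun k => iterate k i 0)); apply: iterate_cvg.
have to_step : (iterate k.+1 i 0 @[k --> \oo] --> step minsol i 0)%classic.
  have stepE x : step x i 0 = alpha * bil x x i 0 + (1 - alpha) * v i 0.
    by rewrite !mxE.
  rewrite stepE; under eq_cvg do rewrite stepE.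
  apply: cvgD; last exact: cvg_cst.
  apply: cvgM; first exact: cvg_cst.
  by apply: bil_cvg => j; apply: iterate_cvg.
by rewrite -(cvg_lim _ to_min) // (cvg_lim _ to_step).
Qed.

Lemma minsol_ge0 : lemx 0 minsol.
Proof.
move=> i j; rewrite ord1 [X in X <= _]mxE; apply: (cvgr_to_ge (@iterate_cvg i)).
by apply: nearW => k; apply/coord_ge0/iterate_ge0.
Qed.

Lemma minsol_minimal : minimal_nonneg (pagerank_solution alpha v R) minsol.
Proof.
split; [exact: minsol_fixed | exact: minsol_ge0 | move=> x xsol x0 i j].
rewrite ord1; apply: (cvgr_to_le (@iterate_cvg i)); apply: nearW => k.
exact: iterate_le_solution.
Qed.

Lemma minsol_mass_le c : 0 <= c -> c = alpha * c ^+ 2 + (1 - alpha) ->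
  mass minsol <= c.
Proof.
move=> c0 cE.
have mc : (mass (iterate k) @[k --> \oo] --> mass minsol)%classic.
  apply: cvg_big => [|i _]; [exact: add_continuous | exact: iterate_cvg].
by apply: (cvgr_to_le mc); apply: nearW => k; apply: iterate_mass.
Qed.

(** Taking masses in the equation leaves [t = alpha t ^ 2 + (1 - alpha)], whose
    roots are 1 and [(1 - alpha) / alpha]. *)
Lemma minsol_mass_root :
  (mass minsol - 1) * (alpha * mass minsol - (1 - alpha)) = 0.
Proof.
have e := congr1 mass minsol_fixed; rewrite step_mass in e.
have h : mass minsol - (alpha * mass minsol ^+ 2 + (1 - alpha)) = 0.
  by rewrite -e subrr.
rewrite -[RHS]oppr0 -[in RHS]h; ring.
Qed.

Lemma minsol_mass_sub : alpha <= 1 / 2 -> mass minsol = 1.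
Proof.
move=> ha; have le1 : mass minsol <= 1 by apply: minsol_mass_le => //; lra.
have /eqP := minsol_mass_root; rewrite mulf_eq0 => /orP[]/eqP; first by lra.
move=> e; apply: le_anti; rewrite le1 /= -(ler_pM2l alpha_gt0); lra.
Qed.

Lemma minsol_mass_super : 1 / 2 < alpha -> mass minsol = (1 - alpha) / alpha.
Proof.
move=> ha; have a0 : alpha != 0 by rewrite gt_eqF.
have le1 : mass minsol <= (1 - alpha) / alpha.
  apply: minsol_mass_le; first by rewrite divr_ge0 ?subr_ge0 ?ltW.
  by field.
have lt1 : (1 - alpha) / alpha < 1 by rewrite ltr_pdivrMr //; lra.
have /eqP := minsol_mass_root; rewrite mulf_eq0 => /orP[]/eqP; first by lra.
by move/subr0_eq <-; rewrite [alpha * _]mulrC mulfK.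
Qed.

(** * A stochastic solution in the supercritical case *)

(** The map [G] below takes [z] to the [z'] such that
    [step (m + r z) = m + r z']; the equation [alpha (2 mass m + r) = 1] makes it
    preserve the simplex. *)
Lemma stochastic_above (m : 'cV[K]_n) (r : K) : (0 < n)%N -> 0 <= r ->
  pagerank_solution alpha v R m -> lemx 0 m ->
  alpha * (2 * mass m + r) = 1 -> mass m + r = 1 ->
  exists s : 'cV[K]_n,
    [/\ stochastic s, pagerank_solution alpha v R s & lemx m s].
Proof.
move=> n0 r0 msol m0 slope mr.
pose G z : 'cV[K]_n := alpha *: (bil m z + bil z m + r *: bil z z).
have G_mass z : mass (G z) = alpha * (2 * mass m * mass z + r * mass z ^+ 2).
  rewrite expr2 -bil_mass -mulrA -bil_mass.
  have -> : 2 * mass (bil m z) = mass (bil m z) + mass (bil z m).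
    by rewrite !bil_mass; ring.
  rewrite /mass -big_split /= !mulr_sumr -big_split /= !mulr_sumr.
  by apply: eq_bigr => i _; rewrite !(coordD, coordZ).
have G_ge0 z : lemx 0 z -> lemx 0 (G z).
  move=> z0 i j; rewrite ord1 [X in X <= _]mxE !(coordD, coordZ).
  by rewrite mulr_ge0 ?(ltW alpha_gt0) ?addr_ge0 ?mulr_ge0 ?coord_ge0 //;
    apply: bil_ge0.
have G_cvg (T : Type) (F : set_system T) (y : T -> 'cV[K]_n)
    (b : 'cV[K]_n) i : Filter F ->
    (forall j, y t j 0 @[t --> F] --> b j 0)%classic ->
    (G (y t) i 0 @[t --> F] --> G b i 0)%classic.
  move=> FF yb; rewrite !(coordD, coordZ).
  under eq_cvg do rewrite !(coordD, coordZ).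
  have mc j : (m j 0 @[_ --> F] --> m j 0)%classic by apply: cvg_cst.
  apply: cvgM; first exact: cvg_cst.
  apply: cvgD; first by apply: cvgD; apply: bil_cvg.
  by apply: cvgM; [exact: cvg_cst | exact: bil_cvg].
pose f (z : 'rV[K]_n) := (G z^T)^T.
have mass_tr (z : 'rV[K]_n) : mass z^T = \sum_i z 0 i.
  by apply: eq_bigr => i _; rewrite mxE.
have [|i|//|z [z0 zs] fz] := @brouwer_simplex K n f.
- move=> z [z0 zs]; split=> [i|].
    rewrite mxE; have := @G_ge0 z^T _ i 0.
    rewrite [X in X <= _]mxE; apply=> k j.
    by rewrite ord1 !mxE.
  rewrite -mass_tr trmxK G_mass mass_tr zs expr1n !mulr1; exact: slope.
- move=> z; rewrite /f.
  have tr_cvg j : (x^T j 0 @[x --> z] --> (z^T : 'cV[K]_n) j 0)%classic.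
    rewrite mxE; under eq_cvg do rewrite mxE.
    exact: (@coord_continuous K 1 n 0 j).
  rewrite /continuous_at mxE; under eq_cvg do rewrite mxE.
  by apply: G_cvg; first exact: nbhs_filter.
have Gz : G z^T = z^T by rewrite -[in RHS]fz trmxK.
have zT0 : lemx 0 z^T by move=> i j; rewrite ord1 !mxE.
exists (m + r *: z^T); split.
- split.
    move=> i j; rewrite ord1 [X in X <= _]mxE coordD coordZ.
    by rewrite addr_ge0 ?mulr_ge0 ?coord_ge0.
  apply/mul_ones_eq; rewrite -mr -[X in _ = _ + X]mulr1 -zs -mass_tr /mass.
  rewrite mulr_sumr -big_split /=.
  by apply: eq_bigr => i _; rewrite coordD coordZ.
- rewrite /pagerank_solution -/(bil _ _) bil_shift scalerDr addrAC.
  by rewrite -[_ + _ *: v]msol scalerA mulrC -scalerA -/(G z^T) Gz.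
by move=> i j; rewrite !mxE lerDl mulr_ge0 // ord1.
Qed.

End PageRank.

Theorem mainTheorem2 (K : realType) (n : nat) (alpha : K)
    (v : 'cV[K]_n) (R : 'M[K]_(n, n * n))
    (n_ge1 : (1 <= n)%N) (alpha_gt0 : 0 < alpha) (alpha_lt1 : alpha < 1)
    (v_ge0 : lemx 0 v) (v_sum1 : (ones n)^T *m v = 1%:M)
    (R_ge0 : lemx 0 R) (R_sum1 : (ones n)^T *m R = (ones (n * n))^T) :
  exists m : 'cV[K]_n,
    [/\ minimal_nonneg (pagerank_solution alpha v R) m,
        alpha <= 1 / 2 ->
          stochastic m /\
          (forall s : 'cV[K]_n,
             stochastic s -> pagerank_solution alpha v R s -> s = m)
      & 1 / 2 < alpha ->
          [/\ (ones n)^T *m m = ((1 - alpha) / alpha)%:M,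
              (1 - alpha) / alpha < 1,
              ~ stochastic m
            & exists s : 'cV[K]_n,
                [/\ stochastic s, pagerank_solution alpha v R s & lemx m s]]].
Proof.
move/mul_ones_eq: v_sum1 => v_mass.
have R_col k : \sum_i R i k = 1.
  move/matrixP/(_ 0 k): R_sum1; rewrite !mxE => <-.
  by apply: eq_bigr => i _; rewrite !mxE mul1r.
have a0 : alpha != 0 by rewrite gt_eqF.
have m_min := minsol_minimal alpha_gt0 alpha_lt1 v_ge0 v_mass R_ge0 R_col.
exists (minsol alpha v R); split=> // ha.
  have m1 := minsol_mass_sub alpha_gt0 alpha_lt1 v_ge0 v_mass R_ge0 R_col ha.
  have [_ m0 mle] := m_min; split; first by split=> //; apply/mul_ones_eq.
  move=> s [s0 /mul_ones_eq s1] ssol; apply/esym/lemx_mass_eq; first exact: mle.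
  by rewrite m1 s1.
have mm := minsol_mass_super alpha_gt0 alpha_lt1 v_ge0 v_mass R_ge0 R_col ha.
have lt1 : (1 - alpha) / alpha < 1 by rewrite ltr_pdivrMr //; lra.
have [msol m0 _] := m_min.
split=> //; first exact/mul_ones_eq.
  by case=> _ /mul_ones_eq; rewrite mm; lra.
apply: (stochastic_above (r := 1 - (1 - alpha) / alpha)
  alpha_gt0 R_ge0 R_col n_ge1 _ msol m0).
- by rewrite subr_ge0 ltW.
- by rewrite mm; field.
- by rewrite mm; field.
Qed.
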